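(* Let $A=A_0+A_1\mathbf{i}+A_2\mathbf{j}+A_3\mathbf{k}\in\mathbb{Q}_{\mathbb{R}}^{m\times n}$, $B=B_0+B_1\mathbf{i}+B_2\mathbf{j}+B_3\mathbf{k}\in\mathbb{Q}_{\mathbb{R}}^{m\times d}$, $C=C_0+C_1\mathbf{i}+C_2\mathbf{j}+C_3\mathbf{k}\in\mathbb{Q}_{\mathbb{R}}^{p\times n}$, $D=D_0+D_1\mathbf{i}+D_2\mathbf{j}+D_3\mathbf{k}\in\mathbb{Q}_{\mathbb{R}}^{p\times d}$ with real component matrices. Assume $m\ge n+d$ and that $C^R_c$ has full row rank. Then a matrix $X\in\mathbb{R}^{n\times d}$ is a real RBTLSE solution for $(A,B,C,D)$ if and only if it is a real TLSE solution for $(A^R_c,B^R_c,C^R_c,D^R_c)$. Furthermore, let $X$ be a real TLSE solution with corresponding minimizing perturbations $\widetilde{E}=[E_0^T,E_1^T,E_2^T,E_3^T]^T\in\mathbb{R}^{4m\times n}$ and $\widetilde{F}=[F_0^T,F_1^T,F_2^T,F_3^T]^T\in\mathbb{R}^{4m\times d}$, where $E_t\in\mathbb{R}^{m\times n}$ and $F_t\in\mathbb{R}^{m\times d}$ for $t=0,1,2,3$. Then the corresponding minimizing perturbations in the RBTLSE problem are $$\bar{E}=E_0+E_1\mathbf{i}+E_2\mathbf{j}+E_3\mathbf{k}\in\mathbb{Q}_{\mathbb{R}}^{m\times n},\qquad \bar{F}=F_0+F_1\mathbf{i}+F_2\mathbf{j}+F_3\mathbf{k}\in\mathbb{Q}_{\mathbb{R}}^{m\times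 d}.$$
   Context: $\mathbb{Q}_{\mathbb{R}}$ denotes the reduced biquaternions: the commutative real algebra with basis $1,\mathbf{i},\mathbf{j},\mathbf{k}$ and $\mathbf{j}^2=1$, $\mathbf{i}^2=\mathbf{k}^2=-1$, $\mathbf{i}\mathbf{j}=\mathbf{j}\mathbf{i}=\mathbf{k}$, $\mathbf{j}\mathbf{k}=\mathbf{k}\mathbf{j}=\mathbf{i}$, $\mathbf{k}\mathbf{i}=\mathbf{i}\mathbf{k}=-\mathbf{j}$. For $\alpha=\alpha_0+\alpha_1\mathbf{i}+\alpha_2\mathbf{j}+\alpha_3\mathbf{k}$ ($\alpha_t\in\mathbb{R}$), $\|\alpha\|=\sqrt{\alpha_0^2+\alpha_1^2+\alpha_2^2+\alpha_3^2}$; for $P=(p_{ij})\in\mathbb{Q}_{\mathbb{R}}^{m\times n}$, $\|P\|_F=\sqrt{\sum_{i,j}\|p_{ij}\|^2}$. Real matrices are regarded as reduced biquaternion matrices. For $P=P_0+P_1\mathbf{i}+P_2\mathbf{j}+P_3\mathbf{k}\in\mathbb{Q}_{\mathbb{R}}^{m\times n}$ with $P_t\in\mathbb{R}^{m\times n}$, put $P^R_c=[P_0^T,P_1^T,P_2^T,P_3^T]^T\in\mathbb{R}^{4m\times n}$. Real RBTLSE solution for $(A,B,C,D)$: consider the problem $$\min_{X,\bar{E},\bar{F}}\|[\bar{E},\bar{F}]\|_F\quad\text{subject to}\quad (A+\bar{E})X=B+\bar{F},\quad CX=D,$$ over $X\in\mathbb{R}^{n\times d}$, $\bar{E}\in\mathbb{Q}_{\mathbb{R}}^{m\times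 n}$, $\bar{F}\in\mathbb{Q}_{\mathbb{R}}^{m\times d}$. A real matrix $X$ that satisfies the constraints together with perturbations $\bar E,\bar F$ attaining the minimum is a real RBTLSE solution, and such $\bar{E},\bar{F}$ are corresponding minimizing perturbations. Real TLSE solution for $(A^R_c,B^R_c,C^R_c,D^R_c)$: consider the problem $$\min_{X,\widetilde{E},\widetilde{F}}\|[\widetilde{E},\widetilde{F}]\|_F\quad\text{subject to}\quad (A^R_c+\widetilde{E})X=B^R_c+\widetilde{F},\quad C^R_cX=D^R_c,$$ over $X\in\mathbb{R}^{n\times d}$, $\widetilde{E}\in\mathbb{R}^{4m\times n}$, $\widetilde{F}\in\mathbb{R}^{4m\times d}$. A real matrix $X$ that satisfies the constraints together with perturbations $\widetilde E,\widetilde F$ attaining the minimum is a real TLSE solution, and such $\widetilde{E},\widetilde{F}$ are corresponding minimizing perturbations. *)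

(* Defs.v *)
From HB Require Import structures.
From mathcomp Require Import all_boot all_order all_algebra.
From mathcomp Require Import reals ring.

Set Implicit Arguments.
Unset Strict Implicit.
Unset Printing Implicit Defensive.

Import Order.TTheory GRing.Theory Num.Theory.
Local Open Scope ring_scope.

(* [Rbq a0 a1 a2 a3] is a0 + a1 i + a2 j + a3 k, see [rbqE] below. *)
Record rbq (R : Type) : Type := Rbq { rb0 : R; rb1 : R; rb2 : R; rb3 : R }.

Definition tuple_of_rbq (R : Type) (a : rbq R) : R * R * R * R :=
  (rb0 a, rb1 a, rb2 a, rb3 a).
Definition rbq_of_tuple (R : Type) (t : R * R * R * R) : rbq R :=
  let: (a0, a1, a2, a3) := t in Rbq a0 a1 a2 a3.
Lemma tuple_of_rbqK (R : Type) : cancel (@tuple_of_rbq R) (@rbq_of_tuple R).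
Proof. by case. Qed.

HB.instance Definition _ (R : eqType) :=
  Equality.copy (rbq R) (can_type (@tuple_of_rbqK R)).
HB.instance Definition _ (R : choiceType) :=
  Choice.copy (rbq R) (can_type (@tuple_of_rbqK R)).

Section RbqAlgebra.
Variable R : realType.
Implicit Types a b c : rbq R.

Definition rbq_zero : rbq R := Rbq 0 0 0 0.
Definition rbq_opp a : rbq R := Rbq (- rb0 a) (- rb1 a) (- rb2 a) (- rb3 a).
Definition rbq_add a b : rbq R :=
  Rbq (rb0 a + rb0 b) (rb1 a + rb1 b) (rb2 a + rb2 b) (rb3 a + rb3 b).

Fact rbq_addA : associative rbq_add.
Proof. by move=> a b c; rewrite /rbq_add /= !addrA. Qed.
Fact rbq_addC : commutative rbq_add.
Proof. by move=> a b; congr Rbq; rewrite addrC. Qed.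
Fact rbq_add0 : left_id rbq_zero rbq_add.
Proof. by case=> *; rewrite /rbq_add /= !add0r. Qed.
Fact rbq_addN : left_inverse rbq_zero rbq_opp rbq_add.
Proof. by move=> a; rewrite /rbq_add /= !addNr. Qed.

HB.instance Definition _ :=
  GRing.isZmodule.Build (rbq R) rbq_addA rbq_addC rbq_add0 rbq_addN.

Definition rbq_one : rbq R := Rbq 1 0 0 0.
(* Bilinear extension of i^2 = k^2 = -1, j^2 = 1, ij = k, jk = i, ki = -j. *)
Definition rbq_mul a b : rbq R :=
  Rbq (rb0 a * rb0 b - rb1 a * rb1 b + rb2 a * rb2 b - rb3 a * rb3 b)
      (rb0 a * rb1 b + rb1 a * rb0 b + rb2 a * rb3 b + rb3 a * rb2 b)
      (rb0 a * rb2 b + rb2 a * rb0 b - rb1 a * rb3 b - rb3 a * rb1 b)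
      (rb0 a * rb3 b + rb3 a * rb0 b + rb1 a * rb2 b + rb2 a * rb1 b).

Fact rbq_mulA : associative rbq_mul.
Proof. by move=> a b c; congr Rbq; rewrite /=; ring. Qed.
Fact rbq_mulC : commutative rbq_mul.
Proof. by move=> a b; congr Rbq; ring. Qed.
Fact rbq_mul1 : left_id rbq_one rbq_mul.
Proof. by case=> *; congr Rbq; rewrite /=; ring. Qed.
Fact rbq_mulDl : left_distributive rbq_mul rbq_add.
Proof. by move=> a b c; congr Rbq; rewrite /=; ring. Qed.
Fact rbq_one_neq0 : rbq_one != rbq_zero.
Proof. by apply/eqP => -[/eqP]; rewrite oner_eq0. Qed.

HB.instance Definition _ := GRing.Zmodule_isComNzRing.Build (rbq R)
  rbq_mulA rbq_mulC rbq_mul1 rbq_mulDl rbq_one_neq0.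

Definition rbq_scale (x : R) a : rbq R :=
  Rbq (x * rb0 a) (x * rb1 a) (x * rb2 a) (x * rb3 a).

Fact rbq_scaleA x y a : rbq_scale x (rbq_scale y a) = rbq_scale (x * y) a.
Proof. by rewrite /rbq_scale /= !mulrA. Qed.
Fact rbq_scale1 : left_id 1 rbq_scale.
Proof. by case=> *; rewrite /rbq_scale /= !mul1r. Qed.
Fact rbq_scaleDr : right_distributive rbq_scale +%R.
Proof. by move=> x a b; congr Rbq; rewrite mulrDr. Qed.
Fact rbq_scaleDl a : {morph rbq_scale^~ a : x y / x + y}.
Proof. by move=> x y; congr Rbq; rewrite mulrDl. Qed.

HB.instance Definition _ := GRing.Zmodule_isLmodule.Build R (rbq R)
  rbq_scaleA rbq_scale1 rbq_scaleDr rbq_scaleDl.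

Fact rbq_scaleAl (x : R) a b : x *: (a * b) = x *: a * b.
Proof. by congr Rbq; rewrite /=; ring. Qed.

HB.instance Definition _ :=
  GRing.Lmodule_isLalgebra.Build R (rbq R) rbq_scaleAl.
HB.instance Definition _ := GRing.Lalgebra_isComAlgebra.Build R (rbq R).

End RbqAlgebra.

Definition rbq_i {R : realType} : rbq R := Rbq 0 1 0 0.
Definition rbq_j {R : realType} : rbq R := Rbq 0 0 1 0.
Definition rbq_k {R : realType} : rbq R := Rbq 0 0 0 1.

Lemma rbqE (R : realType) (a0 a1 a2 a3 : R) :
  Rbq a0 a1 a2 a3 = a0%:A + a1 *: rbq_i + a2 *: rbq_j + a3 *: rbq_k.
Proof. by congr Rbq; rewrite /=; ring. Qed.

Lemma rbq_mul_table (R : realType) :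
  [/\ @rbq_j R * rbq_j = 1, @rbq_i R * rbq_i = -1 & @rbq_k R * rbq_k = -1] /\
  [/\ @rbq_i R * rbq_j = rbq_k, @rbq_j R * rbq_k = rbq_i
    & @rbq_k R * rbq_i = - rbq_j].
Proof. by split; split; congr Rbq; rewrite /=; ring. Qed.

Definition rbq_norm (R : realType) (a : rbq R) : R :=
  Num.sqrt (rb0 a ^+ 2 + rb1 a ^+ 2 + rb2 a ^+ 2 + rb3 a ^+ 2).

Definition rb_frob (R : realType) (m n : nat) (P : 'M[rbq R]_(m, n)) : R :=
  Num.sqrt (\sum_(i < m) \sum_(j < n) rbq_norm (P i j) ^+ 2).

Definition real_rbmx (R : realType) (m n : nat) (P : 'M[R]_(m, n)) :
  'M[rbq R]_(m, n) := map_mx (in_alg (rbq R)) P.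

(* A real matrix is regarded as a reduced biquaternion matrix; [real_frobE]
   gives the usual formula. *)
Definition real_frob (R : realType) (m n : nat) (P : 'M[R]_(m, n)) : R :=
  rb_frob (real_rbmx P).

Lemma real_frobE (R : realType) (m n : nat) (P : 'M[R]_(m, n)) :
  real_frob P = Num.sqrt (\sum_(i < m) \sum_(j < n) P i j ^+ 2).
Proof.
congr Num.sqrt; apply: eq_bigr => i _; apply: eq_bigr => j _.
rewrite mxE /rbq_norm /= mulr1 !mulr0 expr0n /= !addr0.
by rewrite sqr_sqrtr // sqr_ge0.
Qed.

Definition rbmx (R : realType) (m n : nat) (P0 P1 P2 P3 : 'M[R]_(m, n)) :
    'M[rbq R]_(m, n) :=
  real_rbmx P0 + rbq_i *: real_rbmx P1 + rbq_j *: real_rbmx P2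
  + rbq_k *: real_rbmx P3.

Lemma rbmxE (R : realType) (m n : nat) (P0 P1 P2 P3 : 'M[R]_(m, n)) i j :
  rbmx P0 P1 P2 P3 i j = Rbq (P0 i j) (P1 i j) (P2 i j) (P3 i j).
Proof. by rewrite !mxE; congr Rbq; rewrite /=; ring. Qed.

Lemma rbmx_decomp (R : realType) (m n : nat) (P : 'M[rbq R]_(m, n)) :
  P = rbmx (map_mx (@rb0 R) P) (map_mx (@rb1 R) P)
           (map_mx (@rb2 R) P) (map_mx (@rb3 R) P).
Proof. by apply/matrixP => i j; rewrite rbmxE !mxE; case: (P i j). Qed.

(* The 4m rows are written m + (m + (m + m)), the type produced by [col_mx]. *)
Definition stack4 (R : Type) (m n : nat) (P0 P1 P2 P3 : 'M[R]_(m, n)) :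
    'M[R]_(m + (m + (m + m)), n) :=
  col_mx P0 (col_mx P1 (col_mx P2 P3)).

Definition colR (R : realType) (m n : nat) (P : 'M[rbq R]_(m, n)) :
    'M[R]_(m + (m + (m + m)), n) :=
  stack4 (map_mx (@rb0 R) P) (map_mx (@rb1 R) P)
         (map_mx (@rb2 R) P) (map_mx (@rb3 R) P).

Section RBTLSE.
Variables (R : realType) (m n d p : nat).
Variables (A : 'M[rbq R]_(m, n)) (B : 'M[rbq R]_(m, d)).
Variables (C : 'M[rbq R]_(p, n)) (D : 'M[rbq R]_(p, d)).

Definition RBTLSE_feasible (X : 'M[R]_(n, d))
    (E : 'M[rbq R]_(m, n)) (F : 'M[rbq R]_(m, d)) : Prop :=
  (A + E) *m real_rbmx X = B + F /\ C *m real_rbmx X = D.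

Definition RBTLSE_minimizer (X : 'M[R]_(n, d))
    (E : 'M[rbq R]_(m, n)) (F : 'M[rbq R]_(m, d)) : Prop :=
  RBTLSE_feasible X E F /\
  forall X' E' F', RBTLSE_feasible X' E' F' ->
    rb_frob (row_mx E F) <= rb_frob (row_mx E' F').

Definition real_RBTLSE_solution (X : 'M[R]_(n, d)) : Prop :=
  exists E F, RBTLSE_minimizer X E F.

End RBTLSE.

Section TLSE.
Variables (R : realType) (m n d p : nat).
Variables (A : 'M[R]_(m, n)) (B : 'M[R]_(m, d)).
Variables (C : 'M[R]_(p, n)) (D : 'M[R]_(p, d)).

Definition TLSE_feasible (X : 'M[R]_(n, d))
    (E : 'M[R]_(m, n)) (F : 'M[R]_(m, d)) : Prop :=
  (A + E) *m X = B + F /\ C *m X = D.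

Definition TLSE_minimizer (X : 'M[R]_(n, d))
    (E : 'M[R]_(m, n)) (F : 'M[R]_(m, d)) : Prop :=
  TLSE_feasible X E F /\
  forall X' E' F', TLSE_feasible X' E' F' ->
    real_frob (row_mx E F) <= real_frob (row_mx E' F').

Definition real_TLSE_solution (X : 'M[R]_(n, d)) : Prop :=
  exists E F, TLSE_minimizer X E F.

End TLSE.

(* Main.v *)
(* The map P |-> P^R_c is a norm-preserving linear bijection commuting with
   right multiplication by real matrices, so it identifies the two problems.
   For a fixed X the feasible perturbations form an affine space, so by the
   parallelogram law the minimizing ones are unique. *)

Require Import Defs.
From mathcomp Require Import all_boot all_order all_algebra.
From mathcomp Require Import reals ring lra.

Import Order.TTheory GRing.Theory Num.Theory.
Local Open Scope ring_scope.

Section ColR.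
Set Implicit Arguments.
Unset Strict Implicit.
Variable R : realType.

Lemma colR_rbmx (m n : nat) (P0 P1 P2 P3 : 'M[R]_(m, n)) :
  colR (rbmx P0 P1 P2 P3) = stack4 P0 P1 P2 P3.
Proof. by congr stack4; apply/matrixP => i j; rewrite mxE rbmxE. Qed.

Lemma colR_inj (m n : nat) : injective (@colR R m n).
Proof.
move=> P Q /eq_col_mx[e0 /eq_col_mx[e1 /eq_col_mx[e2 e3]]].
by rewrite (rbmx_decomp P) (rbmx_decomp Q) e0 e1 e2 e3.
Qed.

(** Lets an arbitrary real competitor be lifted to a reduced biquaternion one. *)
Lemma colR_surj (m n : nat) (P : 'M[R]_(m + (m + (m + m)), n)) :
  exists Q, colR Q = P.
Proof.
exists (rbmx (usubmx P) (usubmx (dsubmx P)) (usubmx (dsubmx (dsubmx P)))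
         (dsubmx (dsubmx (dsubmx P)))).
by rewrite colR_rbmx /stack4 !vsubmxK.
Qed.

Lemma colRD (m n : nat) (P Q : 'M[rbq R]_(m, n)) :
  colR (P + Q) = colR P + colR Q.
Proof.
rewrite /colR /stack4 !add_col_mx.
by congr stack4; apply/matrixP => i j; rewrite !mxE.
Qed.

(** A real factor scales the four coordinates separately, so the product never mixes them. This
    fails for a general reduced biquaternion factor. *)
Lemma colRM (m n d : nat) (P : 'M[rbq R]_(m, n)) (X : 'M[R]_(n, d)) :
  colR (P *m real_rbmx X) = colR P *m X.
Proof.
rewrite /colR /stack4 !mul_col_mx; congr stack4; apply/matrixP => i j;
  rewrite !mxE.
- rewrite (big_morph (@rb0 R) (id1 := 0) (op1 := +%R)) //.
  by apply: eq_bigr => k _; rewrite !mxE /=; ring.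
- rewrite (big_morph (@rb1 R) (id1 := 0) (op1 := +%R)) //.
  by apply: eq_bigr => k _; rewrite !mxE /=; ring.
- rewrite (big_morph (@rb2 R) (id1 := 0) (op1 := +%R)) //.
  by apply: eq_bigr => k _; rewrite !mxE /=; ring.
- rewrite (big_morph (@rb3 R) (id1 := 0) (op1 := +%R)) //.
  by apply: eq_bigr => k _; rewrite !mxE /=; ring.
Qed.

Lemma colR_row_mx (m n d : nat) (E : 'M[rbq R]_(m, n)) (F : 'M[rbq R]_(m, d)) :
  colR (row_mx E F) = row_mx (colR E) (colR F).
Proof.
(* Each pass turns a column of rows into a row of columns, innermost first; [stack4] nests three
   [col_mx]. *)
by rewrite /colR /stack4 !map_row_mx; do 3!rewrite -block_mxEv block_mxEh.
Qed.

(** The sum over the stacked rows splits into four blocks, whose entries at the same position add up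
    to one squared [rbq_norm]. *)
Lemma real_frob_colR (m n : nat) (P : 'M[rbq R]_(m, n)) :
  real_frob (colR P) = rb_frob P.
Proof.
rewrite real_frobE; congr Num.sqrt.
rewrite !big_split_ord /= -!big_split; apply: eq_bigr => i _.
rewrite -!big_split; apply: eq_bigr => j _.
rewrite /colR /stack4 !(col_mxEu, col_mxEd) !mxE /rbq_norm sqr_sqrtr /=.
  by ring.
by rewrite !addr_ge0 ?sqr_ge0.
Qed.

End ColR.

Section FrobeniusNorm.
Set Implicit Arguments.
Unset Strict Implicit.
Variables (R : realType) (m n : nat).

Lemma real_frob_sqr (P : 'M[R]_(m, n)) :
  real_frob P ^+ 2 = \sum_(i < m) \sum_(j < n) P i j ^+ 2.
Proof.
rewrite real_frobE sqr_sqrtr // sumr_ge0 // => i _.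
by rewrite sumr_ge0 // => j _; rewrite sqr_ge0.
Qed.

Lemma real_frob_ge0 (P : 'M[R]_(m, n)) : 0 <= real_frob P.
Proof. by rewrite real_frobE sqrtr_ge0. Qed.

Lemma real_frob_eq0 (P : 'M[R]_(m, n)) : real_frob P = 0 -> P = 0.
Proof.
move=> P0; have := real_frob_sqr P; rewrite P0 expr0n /= => /esym/eqP.
have ge0 i : 0 <= \sum_(j < n) P i j ^+ 2.
  by rewrite sumr_ge0 // => j _; rewrite sqr_ge0.
rewrite psumr_eq0 // => /allP rows0.
apply/matrixP => i j; rewrite mxE.
have /= := rows0 i (mem_index_enum i); rewrite psumr_eq0 => [/allP row0|k _].
  by have /= := row0 j (mem_index_enum j); rewrite sqrf_eq0 => /eqP.
exact: sqr_ge0.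
Qed.

(** The parallelogram law, scaled so that the midpoint appears; it is a scalar identity summed over
    the entries. *)
Lemma real_frob_parallelogram (P Q : 'M[R]_(m, n)) :
  real_frob (2^-1 *: (P + Q)) ^+ 2 + real_frob (2^-1 *: (P - Q)) ^+ 2 =
  2^-1 * (real_frob P ^+ 2 + real_frob Q ^+ 2).
Proof.
rewrite !real_frob_sqr -!big_split mulr_sumr; apply: eq_bigr => i _.
rewrite -!big_split mulr_sumr; apply: eq_bigr => j _ /=.
by rewrite !mxE; field.
Qed.

(** Strict convexity: by the parallelogram law, the squared norm of half the difference is the
    common squared norm minus that of the midpoint, hence at most zero. *)
Lemma real_frob_midpoint_inj (P Q : 'M[R]_(m, n)) :
  real_frob P = real_frob Q ->
  real_frob P <= real_frob (2^-1 *: (P + Q)) -> P = Q.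
Proof.
move=> ePQ leP; have := real_frob_parallelogram P Q; rewrite -ePQ => par.
have sqrle : real_frob P ^+ 2 <= real_frob (2^-1 *: (P + Q)) ^+ 2.
  by rewrite ler_sqr ?nnegrE ?real_frob_ge0.
have /eqP : real_frob (2^-1 *: (P - Q)) ^+ 2 = 0.
  by apply/eqP; rewrite eq_le sqr_ge0 andbT; lra.
rewrite sqrf_eq0 => /eqP /real_frob_eq0 /eqP.
by rewrite scaler_eq0 invr_eq0 pnatr_eq0 /= subr_eq0 => /eqP.
Qed.

End FrobeniusNorm.

Section Minimizers.
Set Implicit Arguments.
Unset Strict Implicit.
Variables (R : realType) (m n d p : nat).

Lemma RBTLSE_feasible_colR (A : 'M[rbq R]_(m, n)) (B : 'M[rbq R]_(m, d))
    (C : 'M[rbq R]_(p, n)) (D : 'M[rbq R]_(p, d)) X E F :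
  RBTLSE_feasible A B C D X E F <->
  TLSE_feasible (colR A) (colR B) (colR C) (colR D) X (colR E) (colR F).
Proof.
rewrite /RBTLSE_feasible /TLSE_feasible -!colRD -!colRM.
by split=> [[-> ->] | [/colR_inj -> /colR_inj ->]].
Qed.

Lemma RBTLSE_minimizer_colR (A : 'M[rbq R]_(m, n)) (B : 'M[rbq R]_(m, d))
    (C : 'M[rbq R]_(p, n)) (D : 'M[rbq R]_(p, d)) X E F :
  RBTLSE_minimizer A B C D X E F <->
  TLSE_minimizer (colR A) (colR B) (colR C) (colR D) X (colR E) (colR F).
Proof.
split=> -[feasX minX]; split; try exact/RBTLSE_feasible_colR.
  move=> X' E' F'.
  (* Only this direction needs surjectivity: the real competitors must come from reduced
     biquaternion ones. *)
  have [E1 <-] := colR_surj E'; have [F1 <-] := colR_surj F'.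
  move=> /RBTLSE_feasible_colR /minX.
  by rewrite -!colR_row_mx !real_frob_colR.
move=> X' E' F' /RBTLSE_feasible_colR /minX.
by rewrite -!colR_row_mx !real_frob_colR.
Qed.

Lemma TLSE_minimizer_unique
    (A : 'M[R]_(m, n)) (B : 'M[R]_(m, d)) (C : 'M[R]_(p, n)) (D : 'M[R]_(p, d))
    X E F E' F' :
  TLSE_minimizer A B C D X E F -> TLSE_minimizer A B C D X E' F' ->
  E = E' /\ F = F'.
Proof.
move=> [feas min] [feas' min']; apply: eq_row_mx.
apply: real_frob_midpoint_inj.
  (* Each pair competes against the other, so the norms agree. *)
  by apply/eqP; rewrite eq_le (min _ _ _ feas') (min' _ _ _ feas).
(* The midpoint pair competes with the same [X]; its feasibility remains to be shown. *)
rewrite add_row_mx scale_row_mx; apply: (min X).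
case: feas feas' => [eqX eqC] [eqX' _]; split=> //.
(* With [X] fixed, the constraint makes [E *m X] affine in [F], so averaging preserves it. *)
have eE : E *m X = B + F - A *m X by rewrite -eqX mulmxDl addrC addKr.
have eE' : E' *m X = B + F' - A *m X by rewrite -eqX' mulmxDl addrC addKr.
rewrite mulmxDl -scalemxAl mulmxDl eE eE'.
by apply/matrixP => i j; rewrite !mxE; field.
Qed.

End Minimizers.

Theorem theorem3p1 (R : realType) (m n d p : nat)
    (A : 'M[rbq R]_(m, n)) (B : 'M[rbq R]_(m, d))
    (C : 'M[rbq R]_(p, n)) (D : 'M[rbq R]_(p, d))
    (hmnd : (n + d <= m)%N) (hC : row_free (colR C)) :
  (forall X : 'M[R]_(n, d),
     real_RBTLSE_solution A B C D X <->
     real_TLSE_solution (colR A) (colR B) (colR C) (colR D) X) /\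
  (forall (X : 'M[R]_(n, d))
          (E0 E1 E2 E3 : 'M[R]_(m, n)) (F0 F1 F2 F3 : 'M[R]_(m, d)),
     TLSE_minimizer (colR A) (colR B) (colR C) (colR D) X
       (stack4 E0 E1 E2 E3) (stack4 F0 F1 F2 F3) ->
     RBTLSE_minimizer A B C D X (rbmx E0 E1 E2 E3) (rbmx F0 F1 F2 F3) /\
     (forall (E' : 'M[rbq R]_(m, n)) (F' : 'M[rbq R]_(m, d)),
        RBTLSE_minimizer A B C D X E' F' ->
        E' = rbmx E0 E1 E2 E3 /\ F' = rbmx F0 F1 F2 F3)).
Proof.
split=> [X | X E0 E1 E2 E3 F0 F1 F2 F3].
  split=> [[E [F /RBTLSE_minimizer_colR minEF]] | [E [F]]].
    by exists (colR E), (colR F).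
  have [E' <-] := colR_surj E; have [F' <-] := colR_surj F.
  by move=> /RBTLSE_minimizer_colR; exists E', F'.
(* Reading each [stack4] as the image of an [rbmx] brings the hypothesis into the form that
   transfers. *)
rewrite -!colR_rbmx => minEF; split; first exact/RBTLSE_minimizer_colR.
move=> E' F' /RBTLSE_minimizer_colR minEF'.
by have [/colR_inj -> /colR_inj ->] := TLSE_minimizer_unique minEF' minEF.
Qed.
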